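(* For every integer $n\geq 3$ and every prime power $q$, the finite symplectic dual polar space $DW(2n,q)$ has no ovoid.
   Context: $DW(2n,q)$ is the dual of the symplectic polar space formed by the nonzero totally isotropic subspaces of a $2n$-dimensional vector space over $\mathbb{F}_q$ equipped with a nondegenerate alternating form. The points of $DW(2n,q)$ are the totally isotropic subspaces of vector dimension $n$, and its lines are the totally isotropic subspaces of vector dimension $n-1$; a point is on a line if the $n$-dimensional subspace contains the $(n-1)$-dimensional one. An ovoid of $DW(2n,q)$ is a set of points meeting every line in exactly one point. *)

(* Defs.v *)
From HB Require Import structures.
From mathcomp Require Import all_boot all_order all_algebra.

Set Implicit Arguments.
Unset Strict Implicit.
Unset Printing Implicit Defensive.

Import GRing.Theory.
Local Open Scope ring_scope.

Definition prime_power (q : nat) : Prop :=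
  exists p k : nat, [/\ prime p, (0 < k)%N & q = (p ^ k)%N].

Section SymplecticDualPolarSpace.

Variables (F : fieldType) (V : vectType F).

Definition alternating (B : {biscalar V}) : Prop := forall u, B u u = 0.

(* [sesquilinear.nondegenerate] is only available for forms packaged as
   hermitian or skew-hermitian; for an alternating form the left and right
   radicals agree, so requiring the left one to be trivial loses nothing. *)
Definition nondegenerate_form (B : {biscalar V}) : Prop :=
  forall u, (forall v, B u v = 0) -> u = 0.

Variables (B : {biscalar V}) (n : nat).

Definition totally_isotropic (U : {vspace V}) : Prop :=
  {in U &, forall u v, B u v = 0}.

(* In the dual polar space the points are the maximal totally isotropic
   subspaces and the lines those of dimension one less; [n] is the Witt index,
   so these definitions are meant for [\dim {:V} = 2 * n] and [0 < n]. *)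
Definition DW_point (U : {vspace V}) : Prop :=
  totally_isotropic U /\ \dim U = n.

Definition DW_line (L : {vspace V}) : Prop :=
  totally_isotropic L /\ \dim L = (n - 1)%N.

Definition DW_incident (U L : {vspace V}) : Prop := (L <= U)%VS.

Definition DW_ovoid (O : {vspace V} -> Prop) : Prop :=
  (forall U, O U -> DW_point U) /\
  (forall L, DW_line L -> exists! U, O U /\ DW_incident U L).

End SymplecticDualPolarSpace.

(* Main.v *)
Require Import Defs.
From HB Require Import structures.
From mathcomp Require Import all_boot all_order all_algebra finfield ring zify.
From mathcomp.classical Require Import boolp.

(** Let [O] be an ovoid, [U0] a point of [O], [W] a subspace of [U0] of
    codimension 3, and [q] the order of the field. A symplectic frame adapted
    to [W] and [U0] turns the points meeting [U0] exactly in [W] and contained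
    in the orthogonal of [W] into graphs of symmetric 3 x 3 matrices [A]
    ([graph_point]); the points meeting [U0] in [W] plus one more direction
    [v] also come from such matrices ([infinite_point]), [A] being then only
    relevant through the form it induces on the orthogonal of [v]. Moving [A]
    to [A + t v^T v], with [t] in the field, describes a line of the dual
    polar space whose last point is the infinite point of [v] and [A].

    Let [f A] and [g v A] be 1 or 0 according to whether these two points are
    in [O]. The ovoid condition gives two relations:
    - [sum_t f (A + t v^T v) + g v A = 1] ([line_through_graph]);
    - [sum_t g w (A + t v^T v) = 1] when [w] is not proportional to [v]
      ([line_through_infinite]): the point missing from the sum shares a line
      with [U0], which is already in [O].
    Besides, [g v] is constant on [A + F v^T v]. Let [N A] be the number of
    nonzero [v] with [g v A = 1]. Adding up the relations, the function
    [h A = q (q - 1) f A + N A - (q - 1) (q + 2)] has sum zero over every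
    [A + F v^T v].

    In dimension 3 this forces [h = 0] ([line_sums_determine]). A hyperplane
    [tr (C X) = 0] of the space of symmetric matrices contains some nonzero
    [v^T v], because the ternary quadratic form [v C v^T] has a nontrivial
    zero ([quadratic_form_zero], an instance of Chevalley's theorem); so [h]
    has sum zero over every translate of a hyperplane, and summing over the
    hyperplanes through [A] isolates [h A]. For binary forms this fails, and
    indeed [DW(4, q)] has ovoids.

    Finally, the two relations provide a matrix [A] with [f A = 1], and the
    first one shows that [N A = 0] for it. Then [h A = - 2 (q - 1)] is not zero:
    a contradiction ([no_line_partition]). *)

Set Implicit Arguments.
Unset Strict Implicit.
Unset Printing Implicit Defensive.

Import Order.TTheory GRing.Theory Num.Theory.
Local Open Scope ring_scope.

(** * Quadratic forms over a finite field *)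

(** The exponent is too small for every nonzero element to be a root of
    [X^m - 1]; multiplying the variable by a non-root [a] rescales the sum by
    [a ^ m], which is not 1. For [m = 0], translating by 1 shows that the
    order of the field vanishes in the field. *)
Lemma sum_expr_finField (F : finFieldType) m :
  (m < #|F|.-1)%N -> \sum_(x : F) x ^+ m = 0.
Proof.
case: m => [_|m lt_m].
  have : \sum_(x : F) x = \sum_(x : F) (1 + x) by apply: reindex_inj; apply: addrI.
  rewrite big_split /= => /eqP; rewrite -subr_eq subrr => /eqP e.
  by rewrite [RHS]e; apply: eq_bigr.
have [a a0 am] : exists2 a : F, a != 0 & a ^+ m.+1 != 1.
  have [/existsP[a /andP[]]|/existsPn all1] :=
    boolP [exists a : F, (a != 0) && (a ^+ m.+1 != 1)]; first by exists a.
  set p : {poly F} := 'X^(m.+1) - 1%:P; set rs := [seq a <- enum F | a != 0].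
  have size_p : size p = m.+2 by rewrite size_XnsubC.
  have size_rs : size rs = #|F|.-1.
    rewrite -(cardC1 (0 : F)) cardE size_filter -size_filter /rs; congr size.
    by rewrite /rs !enumT /enum_mem; apply: eq_filter => a; rewrite !inE.
  have p0 : p != 0 by rewrite -size_poly_eq0 size_p.
  have all_rs : all (root p) rs.
    apply/allP => a; rewrite mem_filter => /andP[a0 _].
    by have := all1 a; rewrite a0 negbK /root !hornerE subr_eq0.
  have := max_poly_roots p0 all_rs; rewrite filter_uniq ?enum_uniq // => /(_ isT).
  by rewrite size_p size_rs ltnS leqNgt lt_m.
have : \sum_(x : F) x ^+ m.+1 = \sum_(x : F) (a * x) ^+ m.+1.
  by apply: reindex_inj; apply: mulfI.
under [RHS]eq_bigr do rewrite exprMn.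
rewrite -mulr_sumr => /eqP; rewrite -subr_eq0 -{1}[X in X - _]mul1r -mulrBl mulf_eq0.
by rewrite subr_eq0 eq_sym (negPf am) => /eqP.
Qed.

(** The sum factors over the coordinates, and the bound on the degree leaves a
    coordinate whose exponent is smaller than [q - 1]. *)
Lemma sum_monomial (F : finFieldType) k (s : seq 'I_k) :
  (size s < k * #|F|.-1)%N -> \sum_(v : 'rV[F]_k) \prod_(i <- s) v 0 i = 0.
Proof.
move=> lt_s.
have [i lt_i] : exists i, (count_mem i s < #|F|.-1)%N.
  apply/existsP; apply: contraLR lt_s => /existsPn ge_s; rewrite -leqNgt.
  have -> : (k * #|F|.-1 = \sum_(i < k) #|F|.-1)%N by rewrite sum_nat_const card_ord.
  rewrite -sum1_size.
  rewrite [leqRHS](partition_big id xpredT) //=; apply: leq_sum => i _.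
  by rewrite sum1_count leqNgt ge_s.
rewrite (reindex (fun f : {ffun 'I_k -> F} => \row_i f i)) /=; last first.
  exists (fun v : 'rV_k => [ffun i => v 0 i]) => [f|v] _.
    by apply/ffunP => j; rewrite ffunE mxE.
  by apply/rowP => j; rewrite mxE ffunE.
transitivity (\sum_(f : {ffun 'I_k -> F}) \prod_j f j ^+ count_mem j s).
  apply: eq_bigr => f _.
  rewrite [LHS](partition_big id xpredT) //=; apply: eq_bigr => j _.
  rewrite (eq_bigr (fun=> f j)) => [|l /eqP <-]; last by rewrite mxE.
  by rewrite big_const_seq iter_mulr_1.
rewrite -(bigA_distr_bigA (fun j x => x ^+ count_mem j s)) /=.
by rewrite (bigD1 i) //= sum_expr_finField // mul0r.
Qed.

(** Chevalley's argument. Without nontrivial zero, [Q v ^ (q - 1)] would be the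
    indicator function of the nonzero vectors, whose sum is [q ^ k - 1], that
    is [-1]; but its monomials have degree [2 (q - 1) < k (q - 1)], so that
    their sums vanish. *)
Lemma quadratic_form_zero (F : finFieldType) k (C : 'M[F]_k) :
  (2 < k)%N -> exists2 v : 'rV_k, v != 0 & v *m C *m v^T = 0.
Proof.
move=> k3; have q1 : (0 < #|F|.-1)%N by have := finRing_gt1 F; case: #|F| => [|[]].
pose Q (v : 'rV_k) := (v *m C *m v^T) 0 0.
have QE v : Q v = \sum_(p : 'I_k * 'I_k) C p.1 p.2 * (v 0 p.1 * v 0 p.2).
  rewrite /Q mxE -(pair_bigA _ (fun i j => C i j * (v 0 i * v 0 j))) exchange_big.
  apply: eq_bigr => j _; rewrite !mxE mulr_suml; apply: eq_bigr => i _.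
  by rewrite mulrAC mulrC mulrA.
have sum0 : \sum_v Q v ^+ #|F|.-1 = 0.
  transitivity (\sum_(f : {ffun 'I_#|F|.-1 -> 'I_k * 'I_k})
      (\prod_l C (f l).1 (f l).2) * \sum_(v : 'rV_k)
      \prod_(i <- flatten [seq [:: (f l).1; (f l).2] | l <- enum 'I_#|F|.-1]) v 0 i).
    under [RHS]eq_bigr do rewrite mulr_sumr.
    rewrite [RHS]exchange_big; apply: eq_bigr => v _.
    rewrite QE -[X in _ ^+ X]card_ord -prodr_const bigA_distr_bigA /=.
    apply: eq_bigr => f _; rewrite big_split; congr (_ * _).
    rewrite big_flatten big_map enumT; apply: eq_bigr => l _.
    by rewrite big_cons big_seq1.
  apply: big1 => f _; rewrite sum_monomial ?mulr0 //.
  rewrite size_flatten /shape -map_comp sumnE big_map.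
  rewrite (eq_bigr (fun=> 2)) // big_const_seq count_predT size_enum_ord iter_addn_0.
  by rewrite ltn_pmul2r.
move: sum0; rewrite (bigD1 0) //= => sum0.
have [/existsP[v /andP[v0 /eqP Qv]]|/existsPn noz] :=
    boolP [exists v : 'rV_k, (v != 0) && (Q v == 0)].
  by exists v => //; apply/matrixP => i j; rewrite !ord1 -/(Q v) Qv mxE.
have {}noz v : v != 0 -> Q v != 0 by move=> v0; have := noz v; rewrite v0.
have expQ v : v != 0 -> Q v ^+ #|F|.-1 = 1.
  move=> /noz Qv0; apply: (mulfI Qv0); rewrite -exprS prednK ?expf_card ?mulr1 //.
  exact: leq_trans q1 (leq_pred _).
have sum1 : \sum_(v : 'rV[F]_k) 1 = 0 :> F.
  have := @sum_monomial F k [::]; rewrite /= muln_gt0 q1 (ltnW (ltnW k3)) => /(_ isT) {2}<-.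
  by apply: eq_bigr => v _; rewrite big_nil.
move: sum0; rewrite {1}/Q !mul0mx mxE expr0n (gtn_eqF q1) add0r (eq_bigr _ expQ) => sum0.
by move: sum1; rewrite (bigD1 0) //= sum0 addr0 => /eqP; rewrite oner_eq0.
Qed.

(** * Functions on symmetric matrices with prescribed line sums *)

(** A nonzero linear functional takes all its values equally often. *)
Lemma card_trace_zero (F : finFieldType) k (A : 'M[F]_k) : A != 0 ->
  (#|F| * #|[pred C : 'M[F]_k | \tr (C *m A) == 0%R]| = #|{: 'M[F]_k}|)%N.
Proof.
move=> A0.
have [E trE] : exists E : 'M_k, \tr (E *m A) = 1.
  have [/existsP[i /existsP[j Aij]]|/existsPn no] := boolP [exists i, exists j, A i j != 0].
    exists ((A i j)^-1 *: delta_mx j i); rewrite -scalemxAl mxtraceZ.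
    rewrite /mxtrace (bigD1 j) //= big1 => [|l lj]; last first.
      rewrite mxE big1 // => m _; rewrite mxE (negPf lj) mul0r //.
    rewrite addr0 mxE (bigD1 i) //= big1 => [|m mi]; last first.
      by rewrite mxE (negPf mi) andbF mul0r.
    by rewrite mxE !eqxx mul1r addr0 mulVf.
  case/eqP: A0; apply/matrixP => i j; rewrite mxE.
  by apply/eqP; have /existsPn/(_ j) := no i; rewrite negbK.
rewrite -sum_nat_const -[RHS]sum1_card.
rewrite [RHS](partition_big (fun C => \tr (C *m A)) xpredT) //=.
apply: eq_bigr => t _; rewrite -sum1_card.
rewrite [RHS](reindex_inj (addIr (t *: E))) /=.
apply: eq_bigl => C; rewrite !inE /= mulmxDl mxtraceD -scalemxAl mxtraceZ trE mulr1.
by rewrite -[in RHS]subr_eq0 addrK.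
Qed.

(** Sums over the hyperplane [tr (C X) = 0] vanish because it is invariant under
    translation by some [v^T v], a zero of the quadratic form of [C] providing
    [v]. Adding these sums over all [C] counts [h (A + X)] with a weight that
    takes one value at [X = 0] and another one elsewhere, while the unweighted
    sum also vanishes (it is the case [C = 0]). *)
Lemma line_sums_determine (F : finFieldType) k (h : 'M[F]_k -> int) :
  (2 < k)%N ->
  (forall A (v : 'rV_k), A^T = A -> v != 0 -> \sum_t h (A + t *: (v^T *m v)) = 0) ->
  forall A, A^T = A -> h A = 0.
Proof.
move=> k3 lines A symA.
pose Z (C : 'M[F]_k) := \sum_(X : 'M[F]_k | (X^T == X) && (\tr (C *m X) == 0)) h (A + X).
have q0 : (#|F|%:R : int) != 0.
  by rewrite pnatr_eq0 -lt0n; apply/card_gt0P; exists 0.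
have Z0 C : Z C = 0.
  have [v v0 Cv] := quadratic_form_zero C k3.
  have trv t : \tr (C *m (t *: (v^T *m v))) = 0.
    by rewrite -scalemxAr mxtraceZ mulmxA mxtrace_mulC mulmxA Cv linear0 mulr0.
  have symv t : (t *: (v^T *m v))^T = t *: (v^T *m v).
    by rewrite linearZ /= trmx_mul trmxK.
  apply: (mulfI q0); rewrite mulr0 mulr_natl -sumr_const.
  transitivity (\sum_(t : F) \sum_(X : 'M[F]_k | (X^T == X) && (\tr (C *m X) == 0))
                  h (A + X + t *: (v^T *m v))).
    apply: eq_bigr => t _; rewrite /Z (reindex_inj (addIr (t *: (v^T *m v)))) /=.
    apply: eq_big => X; last by rewrite addrA.
    by rewrite linearD /= symv mulmxDr mxtraceD trv addr0 (inj_eq (addIr _)).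
  rewrite exchange_big big1 // => X /andP[/eqP symX _].
  by apply: lines => //; rewrite linearD /= symA symX.
(* All matrices [C] are used, although distinct ones may define the same
   functional on symmetric matrices: this keeps the weights uniform. *)
have sumZ : \sum_(X : 'M[F]_k | X^T == X)
     h (A + X) * #|[pred C : 'M[F]_k | \tr (C *m X) == 0]|%:R = 0.
  transitivity (\sum_C Z C); last by rewrite big1.
  rewrite /Z; under [RHS]eq_bigr do rewrite big_mkcondr.
  rewrite [RHS]exchange_big; apply: eq_bigr => X _ /=.
  rewrite -big_mkcond sumr_const mulr_natr; congr (_ *+ _).
have sumh : \sum_(X : 'M[F]_k | X^T == X) h (A + X) = 0.
  rewrite -[RHS](Z0 0) /Z; apply: eq_bigl => X.
  by rewrite mul0mx mxtrace0 eqxx andbT.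
move: sumZ => /(congr1 ( *%R #|F|%:R)); rewrite mulr0 mulr_sumr.
rewrite (bigD1 0) ?linear0 ?eqxx //=.
rewrite (eq_bigr (fun X => h (A + X) * #|{: 'M[F]_k}|%:R)); last first.
  by move=> X /andP[_ X0]; rewrite mulrCA -natrM card_trace_zero.
have -> : #|[pred C : 'M[F]_k | \tr (C *m 0) == 0]| = #|{: 'M[F]_k}|.
  by apply: eq_card => C; rewrite !inE mulmx0 mxtrace0 eqxx.
rewrite -mulr_suml; move: sumh; rewrite (bigD1 0) ?linear0 ?eqxx //= addr0.
move=> /eqP; rewrite addrC addr_eq0 => /eqP->.
rewrite mulNr mulrA -mulrBl => /eqP; rewrite mulf_eq0.
rewrite -[X in _ - X]mul1r -mulrBl mulf_eq0 subr_eq0.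
rewrite (eqr_nat _ _ 1) (gtn_eqF (finNzRing_gt1 F)) /= => /orP[/eqP//|].
by rewrite pnatr_eq0 -leqn0 leqNgt; case/negP; apply/card_gt0P; exists 0.
Qed.

(** The combinatorial core: [f] stands for the membership in the ovoid of the
    points disjoint from a fixed one, [g] for that of the points meeting it in
    a single direction, up to the common subspace of all these points. *)
Lemma no_line_partition (F : finFieldType) (f : 'M[F]_3 -> bool) (g : 'rV[F]_3 -> 'M[F]_3 -> bool) :
  (forall A (v : 'rV_3), A^T = A -> v != 0 ->
     \sum_t (f (A + t *: (v^T *m v)))%:R + (g v A)%:R = 1%R :> int) ->
  (forall A (v w : 'rV_3), A^T = A -> v != 0 -> ~~ (w <= v)%MS ->
     \sum_t (g w (A + t *: (v^T *m v)))%:R = 1%R :> int) ->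
  (forall A (v : 'rV_3) t, g v (A + t *: (v^T *m v)) = g v A) ->
  (forall A v c, c != 0 -> g (c *: v) A = g v A) ->
  False.
Proof.
move=> fg gvw gT gZ.
set q : int := #|F|%:R.
have q1 : 1 < q by rewrite ltr1n finNzRing_gt1.
pose N A : int := \sum_(v | v != 0) (g v A)%:R.
pose h A : int := q * (q - 1) * (f A)%:R + N A - (q - 1) * (q + 2).
have card_mult (v : 'rV[F]_3) : v != 0 -> #|[pred w : 'rV[F]_3 | (w != 0) && (w <= v)%MS]|%:R = q - 1.
  move=> v0; rewrite /q.
  have -> : #|F|%:R - 1 = #|F|.-1%:R :> int.
    by rewrite -subn1 natrB // ltnW // finNzRing_gt1.
  rewrite -(cardC1 (0 : F)) -(card_image (f := fun c : F => c *: v)) => [|c c' e]; last first.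
    by apply/eqP; move/eqP: e; rewrite -subr_eq0 -scalerBl scaler_eq0 (negPf v0) orbF subr_eq0.
  congr (_%:R); apply: eq_card => w; rewrite !inE; apply/andP/imageP.
    by case=> w0 /sub_rVP[c wE]; exists c => //; apply: contraNneq w0 => c0; rewrite wE c0 scale0r.
  by case=> c; rewrite !inE => c0 ->; rewrite scaler_eq0 negb_or c0 v0 scalemx_sub.
have card_nz : #|[pred w : 'rV[F]_3 | w != 0]|%:R = q ^+ 3 - 1.
  rewrite (cardC1 (0 : 'rV[F]_3)) card_mx -subn1 natrB ?natrX ?mul1n //.
  by rewrite expn_gt0 ltnW ?finNzRing_gt1.
have h0 : forall A, A^T = A -> h A = 0.
  apply: line_sums_determine => // A v symA v0.
  rewrite sumrB big_split /= sumr_const -mulr_sumr -(mulr_natl (_ * _)) -/q.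
  have -> : \sum_t (f (A + t *: (v^T *m v)))%:R = 1%R - (g v A)%:R :> int.
    by apply/eqP; rewrite eq_sym subr_eq fg.
  (* The [q - 1] multiples [w] of [v] contribute [q * g v A] each, the other
     nonzero vectors contribute 1 each. *)
  have -> : \sum_t N (A + t *: (v^T *m v)) = (q - 1) * q * (g v A)%:R + (q ^+ 3 - 1 - (q - 1)).
    rewrite /N exchange_big (bigID (fun w => (w <= v)%MS)) /=; congr (_ + _).
      rewrite (eq_bigr (fun=> q * (g v A)%:R)); last first.
        move=> w /andP[w0 /sub_rVP[c wE]].
        have c0 : c != 0 by apply: contraNneq w0 => c0; rewrite wE c0 scale0r.
        rewrite wE (eq_bigr (fun=> (g v A)%:R)) => [|t _]; last by rewrite gZ // gT.
        by rewrite sumr_const -[LHS]mulr_natl.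
      by rewrite sumr_const -[LHS]mulr_natl card_mult // mulrA.
    rewrite (eq_bigr (fun=> 1)) => [|w /andP[_ wv]]; last exact: gvw.
    apply/eqP; rewrite sumr_const eq_sym subr_eq -card_nz -(card_mult v v0) -natrD eqr_nat.
    rewrite -(cardID [pred w : 'rV_3 | (w <= v)%MS] [pred w : 'rV_3 | w != 0]) addnC.
    by apply/eqP; congr (_ + _)%N; apply: eq_card => w; rewrite !inE andbC.
  ring.
(* If [g w] does not hold at some matrix [X], then the line of [X] in direction
   [w] contains a solution of [f]; and [g w] cannot hold on a whole line in a
   direction [v] that is not proportional to [w]. *)
have [A symA fA] : exists2 A : 'M[F]_3, A^T = A & f A.
  pose v : 'rV[F]_3 := delta_mx 0 0; pose w : 'rV[F]_3 := delta_mx 0 1.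
  have v0 : v != 0 by apply/eqP => /rowP/(_ 0); rewrite !mxE => /eqP; rewrite oner_eq0.
  have w0 : w != 0 by apply/eqP => /rowP/(_ 1); rewrite !mxE => /eqP; rewrite oner_eq0.
  have wv : ~~ (w <= v)%MS.
    apply/sub_rVP => -[c /rowP/(_ 1)]; rewrite !mxE /= mulr0 => /eqP.
    by rewrite oner_eq0.
  have [/existsP[t gt]|/existsPn all1] := boolP [exists t, ~~ g w (0 + t *: (v^T *m v))].
    have symX : (0 + t *: (v^T *m v))^T = 0 + t *: (v^T *m v).
      by rewrite linearD linearZ /= trmx_mul trmxK linear0.
    have := fg _ w symX w0; rewrite (negPf gt) addr0.
    have [/existsP[s fs]|/existsPn no] :=
      boolP [exists s, f (0 + t *: (v^T *m v) + s *: (w^T *m w))].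
      by exists (0 + t *: (v^T *m v) + s *: (w^T *m w)); rewrite // linearD linearZ /= symX trmx_mul trmxK.
    by rewrite big1 // => s _; rewrite (negPf (no s)).
  have := gvw 0 v w (linear0 _) v0 wv.
  rewrite (eq_bigr (fun=> 1)) => [|t _]; last by have := all1 t; rewrite negbK => ->.
  by rewrite sumr_const => /eqP; rewrite (eqr_nat _ _ 1) (gtn_eqF (finNzRing_gt1 F)).
have gA v : v != 0 -> g v A = false.
  move=> v0; have := fg A v symA v0; case: (g v A) => //.
  rewrite (bigD1 0) //= scale0r addr0 fA => e; suff : (1 : int) + 1 <= 1 by [].
  by rewrite -{3}e lerD2r lerDl sumr_ge0 // => t _; rewrite ler0n.
have := h0 A symA; rewrite /h fA /N big1 => [|v v0]; last by rewrite gA.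
have -> : q * (q - 1) * true%:R + 0 - (q - 1) * (q + 2) = -2 * (q - 1) by rewrite mulr1; ring.
by move/eqP; rewrite mulf_eq0 subr_eq0 (gt_eqF q1).
Qed.

(** * Totally isotropic subspaces and their orthogonals *)

Section AlternatingForm.
Variables (F : fieldType) (V : vectType F) (B : {biscalar V}).
Hypotheses (altB : alternating B) (ndB : nondegenerate_form B).

Lemma alternating_skew u v : B u v = - B v u.
Proof.
have := altB (u + v); rewrite linearDl !linearDr !altB add0r addr0.
by move/eqP; rewrite addr_eq0 => /eqP.
Qed.

(** By nondegeneracy the Gram matrix between a basis of the space and a free
    family has independent columns, hence full row space. *)
Lemma form_realizes m (X : m.-tuple V) (c : 'I_m -> F) :
  free X -> exists d, forall j : 'I_m, B d X`_j = c j.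
Proof.
move=> freeX; pose b := vbasis {:V}.
pose M := \matrix_(i < \dim {:V}, j < m) B b`_i X`_j.
have fullM : row_full M.
  rewrite /row_full -mxrank_tr; apply: inj_row_free => u uM0.
  have BX v : B v (\sum_j u 0 j *: X`_j) = 0.
    rewrite (coord_vbasis (memvf v)) linear_sumlz big1 // => i _.
    move/rowP/(_ i): uM0; rewrite [RHS]mxE mxE => uM0.
    rewrite linearZl_LR linear_sumr /= (eq_bigr (fun j => u 0 j * M^T j i)).
      by rewrite uM0 mulr0.
    by move=> j _; rewrite !mxE linearZr_LR.
  have sum0 : \sum_j u 0 j *: X`_j = 0.
    by apply: ndB => v; rewrite alternating_skew BX oppr0.
  by apply/rowP => j; rewrite mxE; move/freeP: freeX => /(_ (u 0) sum0 j).
have /submxP[u cE] : (\row_j c j <= M)%MS by rewrite submx_full.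
exists (\sum_i u 0 i *: b`_i) => j.
move/rowP/(_ j): cE; rewrite !mxE => ->; rewrite linear_sumlz.
by apply: eq_bigr => i _; rewrite mxE linearZl_LR.
Qed.

Definition form_row m (X : m.-tuple V) (v : V) : 'rV[F]_m := \row_j B v X`_j.

Lemma form_row_is_linear m (X : m.-tuple V) : linear (form_row X).
Proof. by move=> a u v; apply/rowP => j; rewrite !mxE linearPl. Qed.

HB.instance Definition _ m (X : m.-tuple V) :=
  GRing.isLinear.Build F V 'rV[F]_m _ (form_row X) (form_row_is_linear X).

Definition perp (U : {vspace V}) (z : V) := {in U, forall u, B u z = 0}.

Lemma perp_add (U : {vspace V}) u z : perp U z -> B u z = 0 -> perp (U + <[u]>)%VS z.
Proof.
move=> pU Bu _ /memv_addP[x xU [_ /vlineP[c ->] ->]].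
by rewrite linearDl linearZl_LR pU // Bu /= mulr0 addr0.
Qed.

Lemma isotropic_add (U : {vspace V}) u :
  totally_isotropic B U -> perp U u -> totally_isotropic B (U + <[u]>)%VS.
Proof.
move=> tU pU x y xU yU; apply: perp_add xU => [z zU|]; rewrite alternating_skew.
  rewrite (perp_add _ _ yU) ?oppr0 // => [t tU'|]; first exact: tU.
  by rewrite alternating_skew pU ?oppr0.
by rewrite (perp_add pU (altB u) yU) oppr0.
Qed.

Lemma dim_add_line (U : {vspace V}) u : u \notin U -> \dim (U + <[u]>)%VS = (\dim U).+1.
Proof.
move=> uU; rewrite dimv_disjoint_sum.
  by rewrite dim_vline (contraNneq _ uU) ?addn1 // => ->; rewrite mem0v.
apply/eqP; rewrite -subv0; apply/subvP => x /memv_capP[xU /vlineP[c xE]].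
rewrite memv0 xE; have [->|c0] := eqVneq c 0; first by rewrite scale0r.
by case/negP: uU; rewrite -(scalerK c0 u) -xE memvZ.
Qed.

Lemma perp_notin (U : {vspace V}) u z : perp U z -> B u z != 0 -> u \notin U.
Proof. by move=> pU; apply: contraNN => /pU/eqP. Qed.

(** [P] is the kernel of the map sending [z] to its products with a basis of
    [U]; this map is onto by [form_realizes]. *)
Lemma perp_space (U : {vspace V}) : exists2 P : {vspace V},
  forall z, z \in P <-> perp U z & (\dim P + \dim U = \dim {:V})%N.
Proof.
pose f := linfun (form_row (vbasis U)); exists (lker f).
  move=> z; rewrite memv_ker lfunE; split => [/eqP fz u uU|pU].
    rewrite (coord_vbasis uU) linear_sumlz big1 // => j _.
    move/rowP/(_ j): fz; rewrite !mxE => fz.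
    by rewrite linearZl_LR alternating_skew fz /= oppr0 mulr0.
  apply/eqP/rowP => j; rewrite !mxE alternating_skew pU ?oppr0 //.
  by apply/vbasis_mem/mem_nth; rewrite size_tuple.
have := limg_ker_dim f fullv; rewrite capfv => <-; congr (_ + _)%N.
have -> : limg f = fullv.
  apply/eqP; rewrite eqEsubv subvf /=; apply/subvP => c _.
  have [d dE] := form_realizes (fun j => c 0 j) (basis_free (vbasisP U)).
  apply/memv_imgP; exists d; rewrite ?memvf // lfunE.
  by apply/rowP => j; rewrite mxE dE.
by rewrite dimvf; apply: esym; apply: mul1n.
Qed.

Lemma isotropic_exists n : \dim {:V} = (2 * n)%N -> forall k, (k <= n)%N ->
  exists2 U : {vspace V}, totally_isotropic B U & \dim U = k.
Proof.
move=> dimV; elim=> [_|k IHk lt_kn].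
  exists 0%VS; last exact: dimv0.
  by move=> u v; rewrite memv0 => /eqP-> _; rewrite linear0l.
have [U tU dimU] := IHk (ltnW lt_kn).
have [P PE dimP] := perp_space U.
have /subvPn[u uP uU] : ~~ (P <= U)%VS.
  apply: contraL lt_kn => /dimvS; rewrite dimU -leqNgt => le_Pk.
  have : (2 * n <= 2 * k)%N by rewrite -dimV -dimP dimU mul2n -addnn leq_add2r.
  by rewrite leq_pmul2l.
exists (U + <[u]>)%VS; first by apply: isotropic_add => //; apply/PE.
by rewrite dim_add_line // dimU.
Qed.

(** The orthogonal of [L] has dimension [n + 1], so it is spanned by [L], [a]
    and [b]; a point through [L] lies in it and is thus given by a direction
    in the plane of [a] and [b]. The condition [B a b != 0] is what makes [a]
    and [b] independent modulo [L]. *)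
Lemma pencil_member n (L U : {vspace V}) a b :
  (0 < n)%N -> \dim {:V} = (2 * n)%N -> \dim L = (n - 1)%N -> DW_point B n U -> (L <= U)%VS ->
  perp L a -> perp L b -> B a b != 0 ->
  U = (L + <[b]>)%VS \/ exists t, U = (L + <[a + t *: b]>)%VS.
Proof.
move=> n0 dimV dimL [tU dimU] LU pa pb Bab.
have bL : b \notin L by apply: perp_notin pa _; rewrite alternating_skew oppr_eq0.
have dimLx x : x \notin L -> \dim (L + <[x]>)%VS = n.
  by move=> xL; rewrite dim_add_line // dimL subn1 prednK.
have Uline x : x \notin L -> (U <= L + <[x]>)%VS -> U = (L + <[x]>)%VS.
  by move=> xL Ux; apply/eqP; rewrite eqEdim Ux dimU dimLx /=.
have [P PE dimP] := perp_space L.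
have PLab : P = (L + <[b]> + <[a]>)%VS.
  apply/eqP; rewrite eq_sym eqEdim !subv_add -!memvE; apply/andP; split.
    apply/andP; split; last exact/PE.
    apply/andP; split; last exact/PE.
    by apply/subvP => l lL; apply/PE => u uL; apply: tU; apply: (subvP LU).
  rewrite dim_add_line ?dimLx //; last first.
    by apply: (perp_notin (z := b)) => //; apply: perp_add.
  rewrite -(leq_add2r (\dim L)) dimP dimV dimL; lia.
have /subvPn[u uU uL] : ~~ (U <= L)%VS.
  by apply/negP => /dimvS; rewrite dimU dimL leqNgt subn1 ltn_predL n0.
have UE : U = (L + <[u]>)%VS.
  by apply/eqP; rewrite eq_sym eqEdim subv_add LU -memvE uU dimU dimLx /=.
have : u \in P by apply/PE => l lL; apply: tU => //; apply: (subvP LU).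
rewrite PLab => /memv_addP[_ /memv_addP[l lL [_ /vlineP[s ->] ->]] [_ /vlineP[c ->] uE]].
have [c0|c0] := eqVneq c 0.
  left; apply: Uline => //; rewrite UE subv_add addvSl -memvE uE c0 scale0r addr0.
  by rewrite memv_add ?memvZ ?memv_line.
right; exists (s / c); apply: Uline.
  by apply: (perp_notin pb); rewrite linearDl linearZl_LR altB /= mulr0 addr0.
rewrite UE subv_add addvSl -memvE uE.
rewrite -addrA memv_add //; apply/vlineP; exists c.
by rewrite scalerDr scalerA mulrC mulfVK // addrC.
Qed.
End AlternatingForm.

(** * Dual bases in dimension three *)

(** The dot product is the pairing between [d] and [e] in a symplectic frame.
    The dual basis [y], [z], [x] of [v], [w], [u] is what splits the vectors
    orthogonal to [v], over which a graph is fixed along a line of direction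
    [v], from the vector [y] over which it moves. *)
Lemma dual_basis3 (F : fieldType) (v w : 'rV[F]_3) : v != 0 -> ~~ (w <= v)%MS ->
  exists u y z x : 'rV_3,
  [/\ [/\ y *m v^T = 1%:M, y *m w^T = 0 & y *m u^T = 0],
      [/\ z *m v^T = 0, z *m w^T = 1%:M & z *m u^T = 0],
      [/\ x *m v^T = 0, x *m w^T = 0 & x *m u^T = 1%:M]
    & forall s : 'rV_3, s = (s *m v^T) 0 0 *: y + (s *m w^T) 0 0 *: z + (s *m u^T) 0 0 *: x].
Proof.
move=> v0 wv.
have [i uvw] : exists i, ~~ (row i 1%:M <= v + w)%MS.
  apply/row_subPn/negP; rewrite sub1mx /row_full => /eqP rk.
  have := leq_trans (mxrank_adds_leqif v w) (leq_add (rank_leq_row v) (rank_leq_row w)).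
  by rewrite rk.
set u := row i _ in uvw.
pose G : 'M[F]_3 := \matrix_(k < 3) nth v [:: v; w; u] k.
have Gmul (c : 'rV_3) : c *m G = c 0 0 *: v + (c 0 1 *: w + c 0 2%:R *: u).
  rewrite mulmx_sum_row !big_ord_recl big_ord0 !rowK /= addr0.
  by congr (_ *: _ + (_ *: _ + _ *: _)); congr (c 0 _); apply: val_inj.
have unitG : G \in unitmx.
  rewrite -row_free_unit; apply: inj_row_free => c; rewrite Gmul => cG0.
  have c2 : c 0 2%:R = 0.
    apply/eqP; apply: contraNT uvw => c2.
    rewrite -(eqmx_scale _ c2); move: cG0 => /eqP; rewrite addrA addr_eq0 => /eqP cE.
    rewrite -[X in (X <= _)%MS]opprK eqmx_opp -cE addmx_sub_adds ?scalemx_sub //.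
  move: cG0; rewrite c2 scale0r addr0 => cG0.
  have c1 : c 0 1 = 0.
    apply/eqP; apply: contraNT wv => c1.
    rewrite -(eqmx_scale _ c1); move: cG0 => /eqP; rewrite addr_eq0 => /eqP cE.
    by rewrite -[X in (X <= _)%MS]opprK eqmx_opp -cE scalemx_sub.
  move: cG0; rewrite c1 scale0r addr0 => /eqP; rewrite scaler_eq0 (negPf v0) orbF => /eqP c0.
  apply/rowP => k; rewrite mxE.
  by case: k => [[|[|[|//]]] lt_k];
    [rewrite -[RHS]c0|rewrite -[RHS]c1|rewrite -[RHS]c2]; congr (c 0 _); apply: val_inj.
pose D := (invmx G)^T.
have DG : D *m G^T = 1%:M by rewrite -trmx_mul mulmxV ?trmx1.
have GD : G^T *m D = 1%:M by rewrite -trmx_mul mulVmx ?trmx1.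
have DGE k l : row k D *m (row l G)^T = (k == l)%:R%:M.
  apply/matrixP => i' j'; rewrite !ord1 [RHS]mxE eqxx.
  move/matrixP/(_ k l): DG; rewrite !mxE => <-.
  by apply: eq_bigr => m _; rewrite !mxE.
have Dv k : row k D *m v^T = (k == 0)%:R%:M.
  have rG : row 0 G = v by rewrite rowK.
  by rewrite -rG DGE.
have Dw k : row k D *m w^T = (k == 1)%:R%:M.
  have rG : row 1 G = w by rewrite rowK.
  by rewrite -rG DGE.
have Du k : row k D *m u^T = (k == 2%:R)%:R%:M.
  have rG : row 2%:R G = u by rewrite rowK.
  by rewrite -rG DGE.
exists u, (row 0 D), (row 1 D), (row 2%:R D).
rewrite !Dv !Dw !Du /= !raddf0; split=> // s.
have coef k l (r : 'rV_3) : row l G = r -> k = l -> (s *m G^T) 0 k = (s *m r^T) 0 0.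
  by move=> <- ->; rewrite !mxE; apply: eq_bigr => m _; rewrite !mxE.
rewrite -{1}[s]mulmx1 -GD mulmxA mulmx_sum_row !big_ord_recl big_ord0 addr0 addrA.
have -> : lift ord0 (lift ord0 ord0) = 2%:R :> 'I_3 by apply: val_inj.
have -> : lift ord0 ord0 = 1 :> 'I_3 by apply: val_inj.
by rewrite (coef 0 0 v) ?(coef 1 1 w) ?(coef 2%:R 2%:R u) ?rowK.
Qed.

(** * An ovoid seen from one of its points *)

Section Ovoid.
Variables (F : finFieldType) (V : vectType F) (B : {biscalar V}) (n : nat).
Hypotheses (altB : alternating B) (ndB : nondegenerate_form B).
Hypotheses (n3 : (3 <= n)%N) (dimV : \dim {:V} = (2 * n)%N).
Variable O : {vspace V} -> Prop.
Hypothesis ovO : DW_ovoid B n O.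

Lemma ovoid_point_isotropic U : O U -> totally_isotropic B U.
Proof. by case: ovO => pO _ /pO[]. Qed.

Lemma ovoid_unique L U1 U2 : totally_isotropic B L -> \dim L = (n - 1)%N ->
  O U1 -> O U2 -> (L <= U1)%VS -> (L <= U2)%VS -> U1 = U2.
Proof.
move=> tL dimL O1 O2 L1 L2; case: ovO => _ /(_ L) [|U [_ UU]]; first by split.
by rewrite -(UU U1) ?(UU U2).
Qed.

(** By [pencil_member], these are all the points on [L]. No two of them coincide,
    as a point containing [b] and some [a + t b], or two different [a + t b],
    would contain [a] and [b], which are not orthogonal. *)
Lemma ovoid_pencil (L : {vspace V}) a b :
  totally_isotropic B L -> \dim L = (n - 1)%N -> perp B L a -> perp B L b -> B a b != 0 ->
  \sum_(t : F) `[< O (L + <[a + t *: b]>)%VS >]%:R + `[< O (L + <[b]>)%VS >]%:R = 1%R :> int.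
Proof.
move=> tL dimL pa pb Bab.
have [pO lO] := ovO; have [|U [[OU LU] _]] := lO L; first by split.
have uniq U' : O U' -> (L <= U')%VS -> U' = U.
  by move=> OU' LU'; apply: (ovoid_unique tL dimL).
have notb t : b \in U -> a + t *: b \in U -> False.
  move=> bU abU; have := ovoid_point_isotropic OU abU bU.
  by rewrite linearDl linearZl_LR altB /= mulr0 addr0 => /eqP; rewrite (negPf Bab).
have memL c : U = (L + <[c]>)%VS -> c \in U by move=> ->; rewrite memvE addvSr.
have OL c : O (L + <[c]>)%VS -> c \in U.
  by move=> Oc; apply/memL/esym/uniq; rewrite ?addvSl.
have [Ub|[s Us]] := pencil_member altB ndB (ltnW (ltnW n3)) dimV dimL (pO U OU) LU pa pb Bab.
  rewrite -Ub [`[< O U >]]asboolT // big1 ?add0r // => t _.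
  by rewrite asboolF // => /OL; apply/notb/memL.
rewrite (@asboolF (O (L + <[b]>)%VS)) ?addr0; last first.
  by move/OL => bU; apply: (notb s) => //; apply: memL.
rewrite (bigD1 s) //= -Us asboolT // big1 ?addr0 // => t ts.
rewrite asboolF // => /OL atU.
have bU : b \in U.
  have ts0 : t - s != 0 by rewrite subr_eq0.
  rewrite -(scalerK ts0 b) memvZ //.
  have -> : (t - s) *: b = (a + t *: b) - (a + s *: b).
    by rewrite scalerBl opprD addrACA subrr add0r.
  by rewrite memvB // memL.
exact: notb atU.
Qed.

(** A symplectic frame for three of the directions transverse to [W]: [e]
    spans [U0] modulo [W], and [d] is dual to it. *)
Variables (W U0 : {vspace V}) (e d : 'Hom('rV[F]_3, V)).
Hypotheses (OU0 : O U0) (WU0 : (W <= U0)%VS) (eU0 : forall x, e x \in U0).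
Hypothesis dimW : \dim W = (n - 3)%N.
Hypotheses (Wd : forall x, perp B W (d x)) (dd : forall x y, B (d x) (d y) = 0).
Hypothesis de : forall x y, B (d x) (e y) = (x *m y^T) 0 0.

Let tW : totally_isotropic B W.
Proof. by move=> x y xW yW; apply: (ovoid_point_isotropic OU0); apply: (subvP WU0). Qed.

Let We x : perp B W (e x).
Proof. by move=> w wW; apply: (ovoid_point_isotropic OU0) => //; apply: (subvP WU0). Qed.

Let ee x y : B (e x) (e y) = 0.
Proof. exact: (ovoid_point_isotropic OU0). Qed.

Let ed x y : B (e x) (d y) = - (y *m x^T) 0 0.
Proof. by rewrite (alternating_skew altB) de. Qed.

(** Symmetric matrices parametrize in this way the maximal totally isotropic
    subspaces of the span of [d] and [e] that are transverse to the span of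
    [e]; isotropy is [form_graph]. *)
Definition graph (A : 'M[F]_3) := (d + (e \o linfun (mulmxr A)))%VF.

Lemma graphE A x : graph A x = d x + e (x *m A).
Proof. by rewrite add_lfunE comp_lfunE lfunE. Qed.

(** Translating [A] by a multiple of [v^T v] fixes the graph over the vectors
    orthogonal to [v] and moves it elsewhere by a multiple of [e v]. *)
Lemma graph_translate A (v : 'rV_3) t x :
  graph (A + t *: (v^T *m v)) x = graph A x + (t * (x *m v^T) 0 0) *: e v.
Proof.
rewrite !graphE mulmxDr linearD addrA -scalemxAr mulmxA linearZ /=.
by rewrite {1}[x *m v^T]mx11_scalar mul_scalar_mx linearZ /= scalerA.
Qed.

Lemma perp_graph A x : perp B W (graph A x).
Proof. by move=> w wW; rewrite graphE linearDr Wd // We // addr0. Qed.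

Lemma form_graph_e A x y : B (graph A x) (e y) = (x *m y^T) 0 0.
Proof. by rewrite graphE linearDl de ee addr0. Qed.

Lemma form_graph A x y : A^T = A -> B (graph A x) (graph A y) = 0.
Proof.
move=> symA; rewrite !graphE linearDl !linearDr dd ee de ed add0r addr0.
have -> : (y *m (x *m A)^T) 0 0 = (y *m (x *m A)^T)^T 0 0 by rewrite [RHS]mxE.
by rewrite !trmx_mul !trmxK symA mulmxA subrr.
Qed.

Definition graph_point A := (W + (graph A @: {:'rV[F]_3}))%VS.

Definition orth_row (v : 'rV[F]_3) := lker (linfun (mulmxr v^T) : 'Hom('rV[F]_3, 'M[F]_1)).

(** For symmetric [A] and nonzero [v], these are the points of the orthogonal of
    [W] that meet [U0] in [W + <e v>]. *)
Definition infinite_point v A := (W + <[e v]> + (graph A @: orth_row v))%VS.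

Lemma orth_rowE v x : (x \in orth_row v) = (x *m v^T == 0).
Proof. by rewrite memv_ker lfunE. Qed.

Lemma infinite_point_translate A (v : 'rV_3) t :
  infinite_point v (A + t *: (v^T *m v)) = infinite_point v A.
Proof.
congr (_ + _)%VS; apply: eq_in_limg => x; rewrite orth_rowE => /eqP xv.
by rewrite graph_translate xv mxE mulr0 scale0r addr0.
Qed.

Lemma infinite_point_scale A v c : c != 0 -> infinite_point (c *: v) A = infinite_point v A.
Proof.
move=> c0; rewrite /infinite_point.
have -> : orth_row (c *: v) = orth_row v.
  apply/vspaceP => x; rewrite !orth_rowE linearZ /= -scalemxAr scaler_eq0.
  by rewrite (negPf c0).
congr (_ + _ + _)%VS.
rewrite linearZ /=; apply/eqP; rewrite eqEsubv -!memvE memvZ ?memv_line //=.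
by rewrite -[X in X \in _](scalerK c0) memvZ ?memv_line.
Qed.

(** These are the points on the line spanned by [W] and the graph of [A] over
    the vectors orthogonal to [v]. *)
Lemma line_through_graph A (v : 'rV_3) : A^T = A -> v != 0 ->
  \sum_t `[< O (graph_point (A + t *: (v^T *m v))) >]%:R + `[< O (infinite_point v A) >]%:R = 1%R :> int.
Proof.
move=> symA v0.
have [w wv] : exists w : 'rV_3, ~~ (w <= v)%MS.
  have [i vi] : exists i, ~~ (row i 1%:M <= v)%MS.
    apply/row_subPn/negP; rewrite sub1mx /row_full => /eqP rk.
    by have := rank_leq_row v; rewrite rk.
  by exists (row i 1%:M).
have [u [y [z [x [[yv yw yu] [zv zw zu] [xv xw xu] dec]]]]] := dual_basis3 v0 wv.
have one : (1%:M : 'M[F]_1) 0 0 = 1 by rewrite mxE.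
have zero : (0 : 'M[F]_1) 0 0 = 0 by rewrite mxE.
pose L := (W + <[graph A z]> + <[graph A x]>)%VS.
have tWz : totally_isotropic B (W + <[graph A z]>)%VS.
  by apply: isotropic_add => //; apply: perp_graph.
have pWz x' : perp B (W + <[graph A z]>)%VS (graph A x').
  by apply: perp_add; rewrite ?form_graph //; apply: perp_graph.
have tL : totally_isotropic B L by apply: isotropic_add => //; apply: pWz.
have dimL : \dim L = (n - 1)%N.
  rewrite !dim_add_line ?dimW; first by lia.
    by apply: (perp_notin (We w)); rewrite form_graph_e zw one oner_eq0.
  apply: (perp_notin (B := B) (z := e u)); last by rewrite form_graph_e xu one oner_eq0.
  by apply: perp_add (We u) _; rewrite form_graph_e zu zero.
have pa : perp B L (graph A y) by apply: perp_add; rewrite ?form_graph.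
have pb : perp B L (e v).
  apply: perp_add; last by rewrite form_graph_e xv zero.
  by apply: perp_add (We v) _; rewrite form_graph_e zv zero.
have Bab : B (graph A y) (e v) != 0 by rewrite form_graph_e yv one oner_eq0.
rewrite -[RHS](ovoid_pencil tL dimL pa pb Bab); congr (_ + _).
  apply: eq_bigr => t _.
  suff -> : graph_point (A + t *: (v^T *m v)) =
    (L + <[graph A y + t *: e v]>)%VS by [].
  rewrite /graph_point; have -> : {:'rV[F]_3}%VS = (<[z]> + <[x]> + <[y]>)%VS.
    apply/eqP; rewrite eqEsubv subvf andbT; apply/subvP => s _.
    by rewrite [s]dec -addrA addrC !memv_add ?memvZ ?memv_line.
  rewrite !limgD !limg_line !graph_translate zv xv yv zero one !mulr0 mulr1 !scale0r !addr0.
  by rewrite !addvA.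
suff -> : infinite_point v A = (L + <[e v]>)%VS by [].
rewrite /infinite_point; have -> : orth_row v = (<[z]> + <[x]>)%VS.
  apply/eqP; rewrite eqEsubv; apply/andP; split.
    apply/subvP => s; rewrite orth_rowE => /eqP sv.
    by rewrite [s]dec sv zero scale0r add0r memv_add ?memvZ ?memv_line.
  by rewrite subv_add -!memvE !orth_rowE zv xv eqxx.
by rewrite /L limgD !limg_line -!addvA (addvC <[e v]>%VS) !addvA.
Qed.

(** The line to consider is spanned by [W], [e w] and the graph of [A] over the
    vectors orthogonal to both [v] and [w]. It has one more point, the one
    that contains [e v]; that point and [U0] have the line [W + <e w> + <e v>] in
    common, so it is not in the ovoid. *)
Lemma line_through_infinite A (v w : 'rV_3) : A^T = A -> v != 0 -> ~~ (w <= v)%MS ->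
  \sum_t `[< O (infinite_point w (A + t *: (v^T *m v))) >]%:R = 1%R :> int.
Proof.
move=> symA v0 wv.
have [u [y [z [x [[yv yw yu] [zv zw zu] [xv xw xu] dec]]]]] := dual_basis3 v0 wv.
have one : (1%:M : 'M[F]_1) 0 0 = 1 by rewrite mxE.
have zero : (0 : 'M[F]_1) 0 0 = 0 by rewrite mxE.
pose L := (W + <[e w]> + <[graph A x]>)%VS.
have tWw : totally_isotropic B (W + <[e w]>)%VS by apply: isotropic_add.
have pWw x' : (x' *m w^T) 0 0 = 0 -> perp B (W + <[e w]>)%VS (graph A x').
  move=> xw0; apply: perp_add (perp_graph _ _) _.
  by rewrite (alternating_skew altB) form_graph_e xw0 oppr0.
have pWe x' : perp B (W + <[e w]>)%VS (e x') by apply: perp_add.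
have tL : totally_isotropic B L by apply: isotropic_add => //; apply: pWw; rewrite xw zero.
have wW : e w \notin W.
  apply: (perp_notin (perp_graph A z)).
  by rewrite (alternating_skew altB) form_graph_e zw one oppr_eq0 oner_eq0.
have dimL : \dim L = (n - 1)%N.
  rewrite !dim_add_line ?dimW //; first by lia.
  by apply: (perp_notin (pWe u)); rewrite form_graph_e xu one oner_eq0.
have pa : perp B L (graph A y).
  by apply: perp_add; [apply: pWw; rewrite yw zero | rewrite form_graph].
have pb : perp B L (e v) by apply: perp_add => //; rewrite form_graph_e xv zero.
have Bab : B (graph A y) (e v) != 0 by rewrite form_graph_e yv one oner_eq0.
have not_b : ~ O (L + <[e v]>)%VS.
  move=> Ob; have UE : (L + <[e v]>)%VS = U0.
    apply: (@ovoid_unique (W + <[e w]> + <[e v]>)%VS) => //.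
    - exact: isotropic_add.
    - rewrite !dim_add_line ?dimW //; first by lia.
      apply: (perp_notin (B := B) (z := graph A y)).
        by apply: pWw; rewrite yw zero.
      by rewrite (alternating_skew altB) form_graph_e yv one oppr_eq0 oner_eq0.
    - by rewrite addvS // addvSl.
    by rewrite !subv_add WU0 -!memvE !eU0.
  have xU0 : graph A x \in U0.
    by rewrite -UE memvE (subv_trans (addvSr _ _) (addvSl _ _)).
  have := ovoid_point_isotropic OU0 xU0 (eU0 u).
  by rewrite form_graph_e xu one => /eqP; rewrite oner_eq0.
rewrite -[RHS](ovoid_pencil tL dimL pa pb Bab) (@asboolF (O (L + <[e v]>)%VS)) // addr0.
apply: eq_bigr => t _.
suff -> : infinite_point w (A + t *: (v^T *m v)) =
  (L + <[graph A y + t *: e v]>)%VS by [].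
rewrite /infinite_point; have -> : orth_row w = (<[x]> + <[y]>)%VS.
  apply/eqP; rewrite eqEsubv; apply/andP; split.
    apply/subvP => s; rewrite orth_rowE => /eqP sw.
    by rewrite [s]dec sw zero scale0r addr0 addrC memv_add ?memvZ ?memv_line.
  by rewrite subv_add -!memvE !orth_rowE yw xw eqxx.
rewrite limgD !limg_line !graph_translate xv yv zero one.
by rewrite mulr0 mulr1 scale0r addr0 addvA.
Qed.

Lemma framed_ovoid_absurd : False.
Proof.
apply: (@no_line_partition F (fun A => `[< O (graph_point A) >])
          (fun v A => `[< O (infinite_point v A) >])).
- exact: line_through_graph.
- exact: line_through_infinite.
- by move=> A v t; rewrite infinite_point_translate.
- by move=> A v c c0; rewrite infinite_point_scale.
Qed.
End Ovoid.

(** * Symplectic frames and the conclusion *)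

Section Frame.
Variables (F : fieldType) (V : vectType F) (B : {biscalar V}).
Hypotheses (altB : alternating B) (ndB : nondegenerate_form B).

Lemma perp_span (s : seq V) z : {in s, forall x, B x z = 0} -> perp B <<s>>%VS z.
Proof.
elim: s => [_ x|y s IHs s0].
  by rewrite span_nil memv0 => /eqP->; rewrite linear0l.
rewrite span_cons addvC; apply: perp_add; last by rewrite s0 ?mem_head.
by apply: IHs => x xs; rewrite s0 // in_cons xs orbT.
Qed.

(** A dual family exists by nondegeneracy; it is made isotropic by a triangular
    correction, which only alters one of the two products of each pair: the
    correction of [d' i] by [X_k] with [k < i] cancels [B (d' i) (d' k)]. *)
Lemma symplectic_dual m (X : m.-tuple V) :
  free X -> (forall i j : 'I_m, B X`_i X`_j = 0) ->
  exists d : 'I_m -> V, (forall i j, B (d i) (d j) = 0) /\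
    (forall i j : 'I_m, B (d i) X`_j = (i == j)%:R).
Proof.
move=> freeX XX.
have /fin_all_exists[d' d'X] : forall i : 'I_m, exists d, forall j : 'I_m, B d X`_j = (i == j)%:R.
  by move=> i; apply: (form_realizes altB ndB) freeX.
pose S (i : 'I_m) := \sum_(k < m | (k < i)%N) B (d' i) (d' k) *: X`_k.
have d'S (i j : 'I_m) : B (d' i) (S j) = (i < j)%:R * B (d' j) (d' i).
  rewrite linear_sumr /= (eq_bigr (fun k : 'I_m => B (d' j) (d' k) * (i == k)%:R)); last first.
    by move=> k _; rewrite linearZr_LR /= d'X.
  rewrite big_mkcond (bigD1 i) //= eqxx mulr1 big1 => [|k ki].
    by case: (i < j)%N; rewrite ?mul1r ?mul0r addr0.
  by rewrite eq_sym (negPf ki) mulr0 if_same.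
have SX i (j : 'I_m) : B (S i) X`_j = 0.
  by rewrite linear_sumlz big1 // => k _; rewrite linearZl_LR XX /= mulr0.
have SS i j : B (S i) (S j) = 0.
  by rewrite [S j]/S linear_sumr big1 // => k _; rewrite linearZr_LR /= SX mulr0.
exists (fun i => d' i + S i); split=> [i j|i j]; last by rewrite linearDl d'X SX addr0.
rewrite linearDl !linearDr SS addr0 (alternating_skew altB (S i)) !d'S.
have [-> | ij] := eqVneq i j; first by rewrite ltnn altB !mul0r oppr0 !addr0.
have [lt_ij|lt_ji|/val_inj eq_ij] := ltngtP i j; last by rewrite eq_ij eqxx in ij.
  by rewrite mul0r mul1r oppr0 addr0 (alternating_skew altB) addNr.
by rewrite mul0r mul1r addr0 subrr.
Qed.

Definition lincomb k (s : 'I_k -> V) (x : 'rV[F]_k) := \sum_i x 0 i *: s i.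

Lemma lincomb_is_linear k (s : 'I_k -> V) : linear (lincomb s).
Proof.
move=> a x y; rewrite /lincomb scaler_sumr -big_split; apply: eq_bigr => i _ /=.
by rewrite !mxE scalerDl scalerA.
Qed.

HB.instance Definition _ k (s : 'I_k -> V) :=
  GRing.isLinear.Build F 'rV[F]_k V _ (lincomb s) (lincomb_is_linear s).

Lemma form_lincomb k (s s' : 'I_k -> V) x y :
  B (lincomb s x) (lincomb s' y) = \sum_i \sum_j x 0 i * y 0 j * B (s i) (s' j).
Proof.
rewrite linear_sumlz; apply: eq_bigr => i _.
rewrite linearZl_LR linear_sumr mulr_sumr; apply: eq_bigr => j _.
by rewrite linearZr_LR /= mulrA.
Qed.
End Frame.

Theorem corollary2 (n q : nat) (hn : (3 <= n)%N) (hq : prime_power q)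
    (F : finFieldType) (hF : #|F| = q)
    (V : vectType F) (hV : \dim {:V} = (2 * n)%N)
    (B : {biscalar V}) (hBalt : alternating B) (hBnd : nondegenerate_form B) :
  ~ exists O : {vspace V} -> Prop, DW_ovoid B n O.
Proof.
case=> O ovO.
have [L tL dimL] := isotropic_exists hBalt hBnd hV (leq_subr 1 n).
have [U0 [[OU0 _] _]] := ovO.2 L (conj tL dimL).
have [tU0 dimU0] := ovO.1 U0 OU0.
have [X XE] : exists X : n.-tuple V, X = vbasis U0 :> seq V.
  by rewrite -dimU0; exists (vbasis U0).
have freeX : free X by rewrite XE (basis_free (vbasisP U0)).
have XU0 x : x \in tval X -> x \in U0 by rewrite XE; apply: vbasis_mem.
have nthX (i : 'I_n) : X`_i \in U0 by apply/XU0/mem_nth; rewrite size_tuple.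
have [d [dd dX]] := symplectic_dual hBalt hBnd freeX (fun i j => tU0 _ _ (nthX i) (nthX j)).
pose emb := widen_ord hn.
have dX3 (i j : 'I_3) : B (d (emb i)) X`_j = (i == j)%:R by rewrite (dX _ (emb j)).
have freeW : free (drop 3 X) by move: freeX; rewrite -{1}(cat_take_drop 3 X) => /catr_free.
apply: (framed_ovoid_absurd hBalt hBnd hn hV ovO (W := <<drop 3 X>>%VS) (U0 := U0)
  (e := linfun (lincomb (fun i => X`_(emb i)))) (d := linfun (lincomb (fun i => d (emb i))))) => //.
- by apply/span_subvP => x /mem_drop /XU0.
- by move=> x; rewrite lfunE; apply: memv_suml => i _; rewrite memvZ.
- by move/eqP: freeW => ->; rewrite size_drop size_tuple.
- move=> x; rewrite lfunE; apply: perp_span => y /(nthP 0)[k].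
  rewrite size_drop size_tuple nth_drop => lt_k <-.
  have lt_kn : (3 + k < n)%N by lia.
  rewrite (alternating_skew hBalt) linear_sumlz big1 ?oppr0 // => i _.
  rewrite linearZl_LR (dX _ (Ordinal lt_kn)) -val_eqE /= ltn_eqF ?mulr0 //.
  exact: leq_trans (ltn_ord i) (leq_addr _ _).
- move=> x y; rewrite !lfunE /= form_lincomb big1 // => i _.
  by rewrite big1 // => j _; rewrite dd mulr0.
move=> x y; rewrite !lfunE /= form_lincomb mxE; apply: eq_bigr => i _.
rewrite (bigD1 i) //= big1 ?addr0 => [|j ji].
  by rewrite dX3 eqxx mulr1 mxE.
by rewrite dX3 eq_sym (negPf ji) mulr0.
Qed.
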